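(* Let $\beta>0$ with $\beta\ne1$. For every maximization problem, every instance $I$ of it, and every solution constructed for $I$ by a present-biased agent with parameter $\beta$, of cost $c$ (so $c\le\mathrm{opt}(I)$), the cost ratio $\varrho=\frac{\mathrm{opt}(I)}{c}$ satisfies: (i) if $\beta<1$, then $\varrho\le\frac1\beta$; (ii) if $\beta>1$, then $\varrho\le\beta^{c}$.
   Context: **Maximization problems.** An instance $I$ consists of a finite ground set $\mathcal S_I$, a weight function $\omega:\mathcal S_I\to\mathbb N$ (where $\mathbb N=\{1,2,\dots\}$), and a family $F(I)$ of subsets of $\mathcal S_I$, called feasible solutions; the initial instance has at least one nonempty feasible solution. The cost of $S$ is $c(S)=\sum_{x\in S}\omega(x)$, and $\mathrm{opt}(I)=\max_{S\in F(I)}c(S)$. For $x$ belonging to some feasible solution, $I\smallsetminus x$ denotes the instance obtained by assuming $x$ selected in the solution: its ground set is $\mathcal S_I\smallsetminus\{x\}$, its weights are unchanged, and its feasible solutions are the sets $S\smallsetminus\{x\}$ with $S\in F(I)$ and $x\in S$. A maximization problem is a class of instances closed under this operation. **Present-biased agent with parameter $\beta$.** Put $I_0=I$. At step $i\ge0$, the agent computes a pair $(S_i,x_i)$ with $S_i\in F(I_i)$ and $x_i\in S_i$ that maximizes the perceived value $\omega(x)+\beta\,c(S\smallsetminus\{x\})$ among all pairs $(S,x)$ with $S\in F(I_i)$ and $x\in S$, and selects $x_i$. Ties are broken arbitrarily. The agent stops as soon as $\{x_0,\dots,x_i\}$ is an inclusion-wise maximal feasible solution of $I$; otherwise it continues with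 $I_{i+1}=I_i\smallsetminus x_i$. The constructed solution is $\{x_0,\dots,x_k\}$, where $k$ is the last step, and its cost is $c=\sum_{i=0}^k\omega(x_i)$. *)

(* Defs.v *)
From mathcomp Require Import all_boot all_order all_algebra.
From mathcomp Require Import reals.

Set Implicit Arguments.
Unset Strict Implicit.
Unset Printing Implicit Defensive.

Import Order.TTheory GRing.Theory Num.Theory.

(* The ground set is a subset of a finite carrier [T], so that all the
   instances met by the agent share one carrier; the values of [weight]
   outside [ground] are irrelevant. *)
Record instance (T : finType) := Instance {
  ground : {set T};
  weight : T -> nat;
  feasible : {set {set T}};
  weight_gt0 : forall x, x \in ground -> 0 < weight x;
  feasible_sub : forall S, S \in feasible -> S \subset ground
}.

Definition cost (T : finType) (I : instance T) (S : {set T}) : nat :=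
  \sum_(x in S) weight I x.

(* The maximum over an empty family would be 0. *)
Definition opt (T : finType) (I : instance T) : nat :=
  \max_(S in feasible I) cost I S.

Section Residual.
Variables (T : finType) (I : instance T) (x : T).

Definition residual_feasible : {set {set T}} :=
  [set S :\ x | S : {set T} in feasible I & x \in S].

Lemma residual_weight_gt0 y : y \in ground I :\ x -> 0 < weight I y.
Proof. by case/setD1P=> _; apply: weight_gt0. Qed.

Lemma residual_feasible_sub S :
  S \in residual_feasible -> S \subset ground I :\ x.
Proof.
case/imsetP=> S'; rewrite inE => /andP[S'F _] ->.
exact/setSD/feasible_sub.
Qed.

(* Meaningful only when [x] belongs to some feasible solution. *)
Definition residual : instance T :=
  Instance residual_weight_gt0 residual_feasible_sub.

End Residual.

Record maximization_problem := MaximizationProblem {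
  instance_of : forall T : finType, instance T -> Prop;
  instance_of_residual : forall (T : finType) (I : instance T) (x : T),
    instance_of I -> (exists2 S, S \in feasible I & x \in S) ->
    instance_of (residual I x)
}.

Section Agent.
Local Open Scope ring_scope.
Variables (R : realType) (beta : R) (T : finType).

Definition perceived_value (I : instance T) (S : {set T}) (x : T) : R :=
  (weight I x)%:R + beta * (cost I (S :\ x))%:R.

Definition candidate (I : instance T) (S : {set T}) (x : T) : Prop :=
  S \in feasible I /\ x \in S.

Definition best_candidate (I : instance T) (S : {set T}) (x : T) : Prop :=
  candidate I S x /\
  forall (S' : {set T}) (x' : T), candidate I S' x' ->
    perceived_value I S' x' <= perceived_value I S x.

Definition maximal_feasible (I : instance T) (A : {set T}) : bool :=
  maxset (fun S : {set T} => S \in feasible I) A.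

(* [agent_from I A J xs]: started on [I], having selected the elements of [A]
   so far and facing the current instance [J], the agent may select the
   elements of [xs], in this order, and then stop. Nondeterminism accounts for
   arbitrary tie-breaking; maximality refers to the initial instance [I]. *)
Inductive agent_from (I : instance T) :
    {set T} -> instance T -> seq T -> Prop :=
| agent_stop (A : {set T}) (J : instance T) (S : {set T}) (x : T) :
    best_candidate J S x -> maximal_feasible I (x |: A) ->
    agent_from I A J [:: x]
| agent_continue (A : {set T}) (J : instance T) (S : {set T}) (x : T)
    (xs : seq T) :
    best_candidate J S x -> ~~ maximal_feasible I (x |: A) ->
    agent_from I (x |: A) (residual J x) xs ->
    agent_from I A J (x :: xs).

Definition agent_run (I : instance T) (xs : seq T) : Prop :=
  agent_from I set0 I xs.

End Agent.

Definition run_cost (T : finType) (I : instance T) (xs : seq T) : nat :=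
  \sum_(x <- xs) weight I x.

Definition cost_ratio (R : realType) (T : finType) (I : instance T)
    (c : nat) : R :=
  ((opt I)%:R / c%:R)%R.

(* Main.v *)
(* One step of the agent on an instance J selecting x gives
   min(1, beta) * opt J <= w(x) + beta * opt (J \ x),
   because the perceived value of any pair (S*, x* ) is at least
   min(1, beta) * c(S* ). Nothing is left after the last step, so telescoping
   gives beta * opt <= c if beta < 1, and opt <= sum_i beta^i w(x_i) if
   beta > 1, where the number of steps is at most c since weights are at
   least 1. *)
Require Import Defs.
From mathcomp Require Import all_boot all_order all_algebra.
From mathcomp Require Import reals.

Set Implicit Arguments.
Unset Strict Implicit.
Unset Printing Implicit Defensive.

Import Order.TTheory GRing.Theory Num.Theory.
Local Open Scope ring_scope.

Lemma cost_le_opt (T : finType) (I : instance T) (S : {set T}) :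
  S \in feasible I -> (cost I S <= opt I)%N.
Proof. by move=> SF; rewrite /opt (bigD1 S) //= leq_maxl. Qed.

Lemma mem_residual (T : finType) (I : instance T) (S : {set T}) (x : T) :
  S \in feasible I -> x \in S -> S :\ x \in feasible (residual I x).
Proof. by move=> SF xS; apply/imsetP; exists S; rewrite // inE SF xS. Qed.

Lemma cost_split (T : finType) (I : instance T) (S : {set T}) (x : T) :
  x \in S -> cost I S = (weight I x + cost I (S :\ x))%N.
Proof. by move=> xS; rewrite /cost (big_setD1 x). Qed.

(** [m] plays the part of min(1, [beta]); leaving it abstract lets both regimes share one argument,
    with [m := beta] below 1 and [m := 1] above. *)
Lemma perceived_value_ge (R : realType) (beta m : R) (T : finType)
    (I : instance T) (S : {set T}) (x : T) :
  m <= 1 -> m <= beta -> x \in S ->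
  m * (cost I S)%:R <= perceived_value beta I S x.
Proof.
move=> m1 mb xS; rewrite /perceived_value (cost_split _ xS) natrD mulrDr.
by rewrite lerD ?ler_wpM2r ?ler0n // ler_piMl ?ler0n.
Qed.

Lemma best_candidate_opt_le (R : realType) (beta m : R) (T : finType)
    (I : instance T) (S : {set T}) (x : T) :
  0 <= beta -> m <= 1 -> m <= beta -> best_candidate beta I S x ->
  m * (opt I)%:R <= (weight I x)%:R + beta * (opt (residual I x))%:R.
Proof.
move=> b0 m1 mb [[SF xS] best].
have [S0 S0F ->] : {S0 | S0 \in feasible I & opt I = cost I S0}.
  by apply: eq_bigmax_cond; apply/card_gt0P; exists S.
(* An empty optimal solution offers no pair to compare with the agent's choice, but then the left
   side is 0. *)
have [->|[y yS0]] := set_0Vmem S0.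
  by rewrite /cost big_set0 mulr0 addr_ge0 ?mulr_ge0 ?ler0n.
apply: le_trans (perceived_value_ge I m1 mb yS0) _.
apply: le_trans (best S0 y (conj S0F yS0)) _.
rewrite lerD2l ler_wpM2l // ler_nat.
exact: (cost_le_opt (mem_residual SF xS)).
Qed.

(* [J] is [I] with the elements of [A] assumed selected. *)
Definition reached (T : finType) (I : instance T) (A : {set T})
    (J : instance T) : Prop :=
  weight J =1 weight I /\
  feasible J = [set S :\: A | S : {set T} in feasible I & A \subset S].

Lemma reached_refl (T : finType) (I : instance T) : reached I set0 I.
Proof.
split=> //; apply/setP=> S; apply/idP/imsetP => [SF|[S' + ->]].
  by exists S; rewrite ?setD0 // inE SF sub0set.
by rewrite setD0 inE sub0set andbT.
Qed.

Lemma reached_residual (T : finType) (I : instance T) (A : {set T})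
    (J : instance T) (x : T) :
  x \notin A -> reached I A J -> reached I (x |: A) (residual J x).
Proof.
move=> xA [wJ fJ]; split=> //; rewrite /= /residual_feasible fJ.
apply/setP=> S; apply/imsetP/imsetP => [[S1]|[S1]]; rewrite inE.
  case/andP=> /imsetP[S2]; rewrite inE => /andP[S2F AS2] ->.
  rewrite inE => /andP[_ xS2] ->; exists S2; last by rewrite setDDl setUC.
  by rewrite inE S2F subUset sub1set xS2.
case/andP=> S1F; rewrite subUset sub1set => /andP[xS1 AS1] ->.
exists (S1 :\: A); last by rewrite setDDl setUC.
(* Here [x \notin A] matters: it keeps [x] in [S1 :\: A], so that this set survives the passage to
   the residual. *)
by rewrite !inE xA xS1 !andbT; apply/imsetP; exists S1; rewrite // inE S1F.
Qed.

Lemma reached_candidate_notin (T : finType) (I : instance T) (A : {set T})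
    (J : instance T) (S : {set T}) (x : T) :
  reached I A J -> candidate J S x -> x \notin A.
Proof.
case=> _ fJ [+ xS]; rewrite fJ => /imsetP[S' _ defS].
by move: xS; rewrite defS => /setDP[].
Qed.

(** By maximality, a feasible solution containing [A] is [A] itself, so only the empty set can be
    feasible in [J]. This is the base case of the telescoping. *)
Lemma reached_maximal_opt (T : finType) (I : instance T) (A : {set T})
    (J : instance T) :
  reached I A J -> maximal_feasible I A -> opt J = 0%N.
Proof.
case=> wJ fJ /maxsetP[_ maxA]; apply/eqP; rewrite -leqn0.
apply/bigmax_leqP=> S; rewrite fJ => /imsetP[S']; rewrite inE => /andP[SF AS] ->.
by rewrite (maxA _ SF AS) setDv /cost big_set0.
Qed.

(** Distinctness turns the cost of the run into the cost of a set; feasibility bounds that cost by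
    the optimum and places the selected elements in the ground set, where weights are positive. *)
Lemma run_feasible (R : realType) (beta : R) (T : finType) (I : instance T)
    (A : {set T}) (J : instance T) (xs : seq T) :
  agent_from beta I A J xs -> reached I A J ->
  [/\ uniq xs, {in xs, forall x, x \notin A}
    & A :|: [set x in xs] \in feasible I].
Proof.
elim=> {A J xs} [A J S x [cand _] xA_max rJ|A J S x xs [cand _] _ _ IH rJ].
  split=> // [y|].
    by rewrite inE => /eqP->; apply: reached_candidate_notin rJ cand.
  have -> : A :|: [set y in [:: x]] = x |: A.
    by apply/setP=> y; rewrite !inE orbC.
  by case/maxsetP: xA_max.
have xA := reached_candidate_notin rJ cand.
have [xs_uniq xs_notin xsF] := IH (reached_residual xA rJ).
split=> [|y|].
- by rewrite /= xs_uniq andbT; apply/negP=> /xs_notin; rewrite setU11.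
- by rewrite inE => /predU1P[->//|/xs_notin]; rewrite in_setU1 negb_or => /andP[].
- by rewrite set_cons setUCA setUA.
Qed.

Lemma run_opt_le_lt1 (R : realType) (beta : R) (T : finType) (I : instance T)
    (A : {set T}) (J : instance T) (xs : seq T) :
  0 <= beta <= 1 -> agent_from beta I A J xs -> reached I A J ->
  beta * (opt J)%:R <= (run_cost I xs)%:R.
Proof.
case/andP=> b0 b1.
elim=> {A J xs} [A J S x best xA_max rJ|A J S x xs best _ _ IH rJ];
  have rJx := reached_residual (reached_candidate_notin rJ best.1) rJ;
  have := best_candidate_opt_le b0 b1 (lexx beta) best; rewrite (rJ.1 x).
  rewrite (reached_maximal_opt rJx xA_max) /run_cost big_seq1.
  by rewrite mulr0 addr0.
move/le_trans; apply; rewrite /run_cost big_cons natrD lerD2l; exact: IH.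
Qed.

(** The induction carries a coarser bound than the telescoped sum: every weight gets the same factor
    [beta ^+ size xs], which dominates each [beta ^+ i]. *)
Lemma run_opt_le_gt1 (R : realType) (beta : R) (T : finType) (I : instance T)
    (A : {set T}) (J : instance T) (xs : seq T) :
  1 <= beta -> agent_from beta I A J xs -> reached I A J ->
  (opt J)%:R <= beta ^+ size xs * (run_cost I xs)%:R.
Proof.
move=> b1; have b0 : 0 <= beta by apply: le_trans b1.
elim=> {A J xs} [A J S x best xA_max rJ|A J S x xs best _ _ IH rJ];
  have rJx := reached_residual (reached_candidate_notin rJ best.1) rJ;
  have := best_candidate_opt_le b0 (lexx 1) b1 best; rewrite (rJ.1 x) mul1r;
  move/le_trans; apply.
  rewrite (reached_maximal_opt rJx xA_max) /run_cost big_seq1 mulr0 addr0.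
  by rewrite ler_peMl ?ler0n ?exprn_ege1.
rewrite /run_cost big_cons natrD mulrDr lerD //.
  by rewrite ler_peMl ?ler0n ?exprn_ege1.
(* The [beta] in front of the residual optimum accounts for the extra power due to the longer
   list. *)
by rewrite /= exprS -mulrA ler_wpM2l //; apply: IH.
Qed.

Lemma size_le_run_cost (T : finType) (I : instance T) (xs : seq T) :
  {in xs, forall x, x \in ground I} -> (size xs <= run_cost I xs)%N.
Proof.
move=> xsG; rewrite -sum1_size /run_cost big_seq [X in (_ <= X)%N]big_seq.
by apply: leq_sum => x /xsG; apply: weight_gt0.
Qed.

Lemma agent_from_size_gt0 (R : realType) (beta : R) (T : finType)
    (I : instance T) (A : {set T}) (J : instance T) (xs : seq T) :
  agent_from beta I A J xs -> (0 < size xs)%N.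
Proof. by case. Qed.

Theorem theorem5 (R : realType) (beta : R)
    (beta_gt0 : 0 < beta) (beta_neq1 : beta != 1)
    (P : maximization_problem) (T : finType) (I : instance T)
    (I_in_P : instance_of P I)
    (I_nontrivial : exists2 S, S \in feasible I & S != set0)
    (xs : seq T) (run : agent_run beta I xs)
    (c : nat) (c_def : c = run_cost I xs) :
  [/\ (c <= opt I)%N,
      beta < 1 -> cost_ratio R I c <= 1 / beta
    & 1 < beta -> cost_ratio R I c <= beta ^+ c].
Proof.
have rI := reached_refl I.
have [xs_uniq _] := run_feasible run rI; rewrite set0U => xsF.
have size_le : (size xs <= c)%N.
  rewrite c_def size_le_run_cost // => x x_xs.
  by apply: (subsetP (feasible_sub xsF)); rewrite inE.
(* Division by 0 yields 0, so clearing the denominator needs [c] positive: a run selects at least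
   one element. *)
have c_gt0 : 0 < c%:R :> R.
  by rewrite ltr0n (leq_trans (agent_from_size_gt0 run)).
split=> [|b1|b1]; rewrite /cost_ratio ?ler_pdivrMr //.
- suff -> : c = cost I [set x in xs] by apply: cost_le_opt.
  by rewrite c_def /cost /run_cost big_uniq //; apply: eq_bigl => x; rewrite inE.
- rewrite mul1r mulrC ler_pdivlMr // mulrC c_def.
  by apply: run_opt_le_lt1 run rI; rewrite !ltW.
(* Since [1 < beta], the exponent [size xs] may be raised to [c]. *)
- apply: le_trans (run_opt_le_gt1 (ltW b1) run rI) _.
  by rewrite -c_def ler_wpM2r ?ler0n // ler_weXn2l // ltW.
Qed.
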